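(* Let $n$ and $t$ be positive integers with $n\ge 4$ and $t\le n-2$. If $\mathcal A$ and $\mathcal B$ are nonempty cross-$t$-intersecting families in $S_n$, then $$|\mathcal A|+|\mathcal B|\le n!-\sum_{i=0}^{t-1}\binom{n}{i}D_{n-i}+1,$$ where $D_m$ is the number of derangements (fixed-point-free permutations) in $S_m$. Moreover, equality holds if and only if $\{\mathcal A,\mathcal B\}=\{\{\sigma\},\ S_n\setminus N(\sigma)\}$ for some $\sigma\in S_n$.
   Context: $S_n$ is the symmetric group on $[n]=\{1,\dots,n\}$. Families $\mathcal A,\mathcal B\subseteq S_n$ are cross-$t$-intersecting if $|\{i\in[n]:\sigma(i)=\tau(i)\}|\ge t$ for all $\sigma\in\mathcal A$, $\tau\in\mathcal B$. For $\sigma\in S_n$, $N(\sigma)=\{\tau\in S_n: |\{i\in[n]:\sigma(i)=\tau(i)\}|<t\}$. *)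

(* Defs.v *)
From mathcomp Require Import all_boot all_fingroup.

Set Implicit Arguments.
Unset Strict Implicit.
Unset Printing Implicit Defensive.

(* Points are 'I_n = {0, ..., n-1} rather than {1, ..., n}. *)

Definition agree n (s u : 'S_n) : {set 'I_n} := [set i | s i == u i].

Definition cross_intersecting n (t : nat) (A B : {set 'S_n}) : Prop :=
  forall s u : 'S_n, s \in A -> u \in B -> t <= #|agree s u|.

Definition nbrs n (t : nat) (s : 'S_n) : {set 'S_n} :=
  [set u | #|agree s u| < t].

Definition derangements m : {set 'S_m} := [set s : 'S_m | [forall i, s i != i]].

Definition num_derangements m : nat := #|derangements m|.

(* Main.v *)
(** An uncrossing argument, with & and + denoting intersection and union. If the
bound fails for some pair with both families of size at least 2, take such a pair
with |A| + |B| maximal and then |A| minimal, translated so that 1 is in A. Every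
symmetry f of S_n preserving agreement (translations, inversion) turns (A, B) into
the cross-intersecting pairs (A & f A, B + f B) and (A + f A, B & f B). Extremality
forces: if |A & f A| >= 2 then f A = A, and if A & f A = {p} then B + f B consists of
all permutations agreeing with p on at least t points. Conjugations then show that
A is invariant under all transpositions, and the maps u |-> p u^-1 q show that A is
a normal subgroup. If some x <> 1 in A has a fixed point, then A contains all
3-cycles, and multiplying an element of B by 3-cycles yields a derangement in B,
although 1 is in A. Otherwise A acts freely, so |A| <= n, while the n permutations
(k l), l in [n], all have at least t fixed points and lie outside B; hence
|A| + |B| is not large enough. *)
Require Import Defs.
From mathcomp Require Import all_boot all_fingroup.
From mathcomp Require Import zify.

Set Implicit Arguments.
Unset Strict Implicit.
Unset Printing Implicit Defensive.

Local Open Scope group_scope.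

(* Otherwise [lia] sees convertible cardinals as distinct atoms. *)
Ltac card_lia := unfold reverse_coercion in *; lia.

(** * Balls and the symmetries that preserve agreement *)

Definition ball n (t : nat) (s : 'S_n) : {set 'S_n} := [set u | t <= #|agree s u|].

Definition agree_preserving n (f : 'S_n -> 'S_n) : Prop :=
  injective f /\ forall s u, #|agree (f s) (f u)| = #|agree s u|.

Lemma agreeC n (s u : 'S_n) : agree s u = agree u s.
Proof. by apply/setP=> i; rewrite !inE eq_sym. Qed.

Lemma agree_preserving_mull n (g : 'S_n) : agree_preserving (fun u => g * u).
Proof.
split=> [|s u]; first exact: mulgI.
rewrite -[RHS](card_preimset _ (@perm_inj _ g)).
by apply: eq_card => i; rewrite !inE !permM.
Qed.

Lemma agree_preserving_mulr n (g : 'S_n) : agree_preserving (fun u => u * g).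
Proof.
split=> [|s u]; first exact: mulIg.
by apply: eq_card => i; rewrite !inE !permM (inj_eq perm_inj).
Qed.

Lemma agree_preserving_inv n : agree_preserving (fun u : 'S_n => u^-1).
Proof.
split=> [|s u]; first exact: invg_inj.
rewrite -[LHS](card_preimset _ (@perm_inj _ s)).
by apply: eq_card => i; rewrite !inE permK -(inj_eq (@perm_inj _ u)) permKV eq_sym.
Qed.

Lemma agree_preserving_comp n (f g : 'S_n -> 'S_n) :
  agree_preserving f -> agree_preserving g -> agree_preserving (f \o g).
Proof.
move=> [fI fA] [gI gA]; split; first exact: inj_comp.
by move=> s u /=; rewrite fA gA.
Qed.

Lemma agree_preserving_conj n (g : 'S_n) : agree_preserving (conjg^~ g).
Proof.
exact: (agree_preserving_comp (agree_preserving_mull g^-1) (agree_preserving_mulr g)).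
Qed.

Lemma card_ball n t (s : 'S_n) : #|ball t s| = #|ball t (1 : 'S_n)|.
Proof.
have [sI sA] := agree_preserving_mull s.
rewrite -(card_preimset (ball t s) sI); apply: eq_card => u.
by rewrite !inE -{1}[s]mulg1 sA.
Qed.

Lemma crossC n t (A B : {set 'S_n}) :
  cross_intersecting t A B -> cross_intersecting t B A.
Proof. by move=> cAB s u Bs Au; rewrite agreeC; apply: cAB. Qed.

Lemma cross_imset n t (A B : {set 'S_n}) (f : 'S_n -> 'S_n) :
  agree_preserving f -> cross_intersecting t A B ->
  cross_intersecting t (f @: A) (f @: B).
Proof.
by move=> [_ fA] cAB _ _ /imsetP[s As ->] /imsetP[u Bu ->]; rewrite fA; apply: cAB.
Qed.

Lemma cross_setIU n t (A B A' B' : {set 'S_n}) :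
  cross_intersecting t A B -> cross_intersecting t A' B' ->
  cross_intersecting t (A :&: A') (B :|: B').
Proof.
move=> cAB cAB' s u /setIP[As A's] /setUP[Bu|Bu]; [exact: cAB | exact: cAB'].
Qed.

Lemma cross_sub_ball n t (A B : {set 'S_n}) s :
  cross_intersecting t A B -> s \in A -> B \subset ball t s.
Proof. by move=> cAB As; apply/subsetP=> u Bu; rewrite inE; apply: cAB. Qed.

(* A putative counterexample of maximal total size and, among these, with the
   smaller family as small as possible. *)
Definition atom n t (A B : {set 'S_n}) : Prop :=
  [/\ cross_intersecting t A B, 1 < #|A|, #|A| <= #|B|,
      #|ball t (1 : 'S_n)| < #|A| + #|B|
    & forall A' B' : {set 'S_n}, cross_intersecting t A' B' -> 1 < #|A'| -> 1 < #|B'| ->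
        #|A'| + #|B'| <= #|A| + #|B| /\
        (#|A'| + #|B'| = #|A| + #|B| -> #|A| <= #|A'|)].

(** The swapped pair competes in the minimisation too, whence [#|A'| <= #|B'|]; a translation by the
    inverse of a member then brings 1 into the smaller family. *)
Lemma exists_atom n t (A B : {set 'S_n}) :
  cross_intersecting t A B -> 1 < #|A| -> 1 < #|B| ->
  #|ball t (1 : 'S_n)| < #|A| + #|B| ->
  exists A' B' : {set 'S_n}, atom t A' B' /\ 1 \in A'.
Proof.
move=> cAB A2 B2 gtM.
pose P (p : {set 'S_n} * {set 'S_n}) :=
  [&& [forall s in p.1, forall u in p.2, t <= #|agree s u|], 1 < #|p.1| & 1 < #|p.2|].
have crossP A' B' : reflect [/\ cross_intersecting t A' B', 1 < #|A'| & 1 < #|B'|] (P (A', B')).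
  apply: (iffP and3P) => /= -[cAB' ? ?]; split=> //.
    by move=> s u As Bu; move/forall_inP: cAB' => /(_ s As) /forall_inP /(_ u Bu).
  by apply/forall_inP=> s As; apply/forall_inP=> u Bu; apply: cAB'.
have P0 : P (A, B) by apply/crossP.
case: (@arg_maxnP _ (A, B) P (fun p => #|p.1| + #|p.2|) P0) => -[A1 B1] P1 max1.
pose Q p := P p && (#|p.1| + #|p.2| == #|A1| + #|B1|).
have Q1 : Q (A1, B1) by rewrite /Q P1 /=.
case: (@arg_minnP _ (A1, B1) Q (fun p => #|p.1|) Q1) => -[A2' B2'] /andP[P2 /eqP /= eq2] min2.
have /crossP[c2 A22 B22] := P2.
have [a Aa] : exists a, a \in A2' by apply/set0Pn; rewrite -card_gt0; card_lia.
have [gI gA] := agree_preserving_mull a^-1.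
exists [set a^-1 * u | u in A2'], [set a^-1 * u | u in B2']; split; last first.
  by rewrite -(mulVg a); apply: imset_f.
rewrite /atom !card_imset //; split=> //.
- exact/cross_imset.
- apply: (min2 (B2', A2')); rewrite /Q /= addnC eq2 eqxx andbT.
  by apply/crossP; split=> //; apply: crossC.
- by rewrite eq2; apply: leq_trans gtM (max1 (A, B) P0).
- move=> A' B' c' A'2 B'2; have P' : P (A', B') by apply/crossP.
  split; first by rewrite eq2; apply: (max1 _ P').
  by move=> eq'; apply: (min2 (A', B')); rewrite /Q P' /= eq' eq2.
Qed.

(** * Uncrossing an extremal pair with a symmetry *)

(** The two uncrossed pairs together have size [2 * (#|A| + #|B|)]. Maximality for the first and
    [#|A| <= #|B|] give [#|B :&: f @: B| > 1], so both are maximal, and minimality of [#|A|] applies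
    to the first. *)
Lemma atom_image_eq n t (A B : {set 'S_n}) f :
  atom t A B -> agree_preserving f -> 1 < #|A :&: f @: A| -> f @: A = A.
Proof.
move=> [cAB A2 leAB _ maxAB] fP I2; have cf := cross_imset fP cAB.
have [fI _] := fP.
have eA : #|f @: A| = #|A| by rewrite card_imset.
have eB : #|f @: B| = #|B| by rewrite card_imset.
have cA := cardsUI A (f @: A); have cB := cardsUI B (f @: B).
have leB : #|B| <= #|B :|: f @: B| by rewrite subset_leq_card ?subsetUl.
have leA : #|A| <= #|A :|: f @: A| by rewrite subset_leq_card ?subsetUl.
have [|le1 min1] := maxAB _ _ (cross_setIU cAB cf) I2; first by card_lia.
have [le2 _] : _ /\ _ :=
  maxAB _ _ (crossC (cross_setIU (crossC cAB) (crossC cf))) ltac:(card_lia) ltac:(card_lia).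
have /min1 leI : #|A :&: f @: A| + #|B :|: f @: B| = #|A| + #|B| by card_lia.
apply/esym/eqP; rewrite eqEcard eA leqnn andbT; apply/setIidPl/eqP.
by rewrite eqEcard subsetIl leI.
Qed.

(** If [B :|: f @: B] missed a point of the ball, [B :&: f @: B] would have two elements and, with
    [A :|: f @: A], exceed the maximal total. *)
Lemma atom_image_ball n t (A B : {set 'S_n}) f p :
  atom t A B -> agree_preserving f -> A :&: f @: A = [set p] ->
  B :|: f @: B = ball t p.
Proof.
move=> [cAB A2 leAB gtM maxAB] fP I1; have cf := cross_imset fP cAB.
have [fI _] := fP.
have eA : #|f @: A| = #|A| by rewrite card_imset.
have eB : #|f @: B| = #|B| by rewrite card_imset.
have cA := cardsUI A (f @: A); have cB := cardsUI B (f @: B).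
rewrite I1 cards1 in cA.
have sub : B :|: f @: B \subset ball t p.
  by apply: cross_sub_ball (cross_setIU cAB cf) _; rewrite I1 set11.
apply/eqP; rewrite eqEcard sub card_ball leqNgt; apply/negP => ltM.
have leA : #|A| <= #|A :|: f @: A| by rewrite subset_leq_card ?subsetUl.
have [le2 _] : _ /\ _ :=
  maxAB _ _ (crossC (cross_setIU (crossC cAB) (crossC cf))) ltac:(card_lia) ltac:(card_lia).
card_lia.
Qed.

Lemma atom_fix n t (A B : {set 'S_n}) f c :
  atom t A B -> agree_preserving f -> f @: A = A -> c \in B -> f c \in B.
Proof.
move=> [cAB A2 leAB _ maxAB] fP fA Bc; have cf := cross_imset fP cAB.
have := cross_setIU cAB cf; rewrite fA setIid => cU.
have leB : #|B| <= #|B :|: f @: B| by rewrite subset_leq_card ?subsetUl.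
have [|le1 _] := maxAB _ _ cU A2; first by card_lia.
have /eqP -> : B == B :|: f @: B by rewrite eqEcard subsetUl; card_lia.
by rewrite inE imset_f ?orbT.
Qed.

(** Conjugation fixes 1, so if [A :^ g] differs from [A], they meet in 1 alone; then [B] and
    [B :^ g] cover the ball, including [c]. *)
Lemma atom_norm n t (A B : {set 'S_n}) c g :
  atom t A B -> 1 \in A -> c \in ball t (1 : 'S_n) -> c \notin B -> c ^ g^-1 \notin B ->
  g \in 'N(A).
Proof.
move=> atAB A1 Cc nBc nBcg; apply/normP/eqP; apply: contraT => neqA.
have gP := agree_preserving_conj g.
have I1 : A :&: A :^ g = [set 1].
  apply/eqP; rewrite eq_sym eqEcard sub1set inE A1 mem_conjg conj1g A1 cards1 leqNgt.
  by apply: contra neqA => /(atom_image_eq atAB gP) /eqP.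
have := Cc; rewrite -(atom_image_ball atAB gP I1) inE (negPf nBc) /=.
by rewrite -/(B :^ g) mem_conjg (negPf nBcg).
Qed.

(** * Conjugation invariance and group structure of the smaller family *)

Lemma perm_neq1_moves (T : finType) (x : {perm T}) : x != 1 -> exists k, x k != k.
Proof.
move=> nx1; apply/existsP; apply: contraNT nx1 => /existsPn nx.
by apply/eqP/permP => i; rewrite perm1; apply/eqP; rewrite -[_ == _]negbK.
Qed.

Lemma exists_neq1 n (A : {set 'S_n}) : 1 < #|A| -> exists2 x, x != 1 & x \in A.
Proof.
move=> /card_gt1P[y [z [Ay Az nyz]]].
by have [y1|ny1] := eqVneq y 1; [exists z; rewrite // -y1 eq_sym | exists y].
Qed.

Lemma exists_perm_support (T : finType) (V : {set T}) :
  1 < #|V| -> exists c : {perm T}, forall i, (c i != i) = (i \in V).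
Proof.
move: {2}#|V|.-2 (erefl #|V|.-2) => m; elim: m V => [|m IHm] V eV V2.
  have /cards2P[a [b [nab ->]]] : #|V| == 2 by card_lia.
  exists (tperm a b) => i; rewrite !inE.
  by case: tpermP => [->|->|/eqP/negPf-> /eqP/negPf->];
     rewrite ?eqxx ?orbT // ?(negPf nab) // eq_sym.
have [k Vk] : exists k, k \in V by apply/set0Pn; rewrite -card_gt0; card_lia.
have cV := cardsD1 k V; rewrite Vk in cV.
have [c suppc] := IHm (V :\ k) ltac:(card_lia) ltac:(card_lia).
have [v Vv] : exists v, v \in V :\ k by apply/set0Pn; rewrite -card_gt0; card_lia.
have ck : c k = k by apply/eqP; rewrite -[_ == _]negbK suppc !inE eqxx.
have /setD1P[nvk _] := Vv.
(* This inserts [k] into a cycle of [c], just before [v]. *)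
exists (c * tperm k v) => i; rewrite permM.
have [->|nik] := eqVneq i k; first by rewrite ck tpermL nvk Vk.
have := suppc i; rewrite !inE nik /= => <-.
have nck : c i != k by rewrite -ck (inj_eq perm_inj).
case: tpermP nck => [->|civ _|//]; first by rewrite eqxx.
rewrite eq_sym nik civ; apply/esym/eqP => evi.
by have := Vv; rewrite -suppc evi civ evi eqxx.
Qed.

Lemma exists_subset_card (T : finType) (F : {set T}) m :
  m <= #|F| -> exists2 W : {set T}, W \subset F & #|W| = m.
Proof.
rewrite -bin_gt0 -cards_draws card_gt0 => /set0Pn[W].
by rewrite inE => /andP[sWF /eqP cW]; exists W.
Qed.

(* Let c move exactly the points of V = k |: (F :\: W), where F is the set of fixed
   points of x and W consists of t - 1 of them. Then c agrees with x on W only, so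
   c is not in B, and c ^ tperm j k has the same support as c. *)
Lemma atom_tperm_norm n t (A B : {set 'S_n}) x j k :
  atom t A B -> 0 < t -> 1 \in A -> 1 \in B -> x \in A -> x j = j -> x k != k ->
  tperm j k \in 'N(A).
Proof.
move=> atAB t0 A1 B1 Ax xj xk; have [cAB _ _ _ _] := atAB.
pose F := agree x 1.
have inF i : (i \in F) = (x i == i) by rewrite inE perm1.
have tF : t <= #|F| by apply: cAB.
have cF := cardsD1 j F; rewrite inF xj eqxx in cF.
have [|W sWF cW] := @exists_subset_card _ (F :\ j) t.-1; first by card_lia.
have WF i : i \in W -> (i != j) && (x i == i).
  by move/(subsetP sWF); rewrite !inE perm1.
pose V := k |: (F :\: W).
have VE i : (i \in V) = (i == k) || (i \notin W) && (x i == i) by rewrite in_setU1 in_setD inF.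
have Vj : j \in V by rewrite VE xj eqxx andbT (contraNN (@WF j)) ?orbT // eqxx.
have Vk : k \in V by rewrite VE eqxx.
have njk : j != k by apply: contraNneq xk => <-; rewrite xj.
have V2 : 1 < #|V|.
  have <- : #|[set j; k]| = 2 by rewrite cards2 njk.
  by apply/subset_leq_card/subsetP=> i /set2P[] ->.
have [c suppc] := exists_perm_support V2.
have supp_ball (d : 'S_n) : (forall i, (d i != i) = (i \in V)) -> d \in ball t (1 : 'S_n).
  move=> suppd; rewrite inE.
  have xkW : x k \notin W.
    by apply/negP => /WF; rewrite (inj_eq perm_inj) (negPf xk) andbF.
  (* The point [x k] lies outside [V], so it joins [W] to make [t] fixed points of [d]. *)
  have : #|x k |: W| = t by rewrite cardsU1 xkW cW; card_lia.
  move=> {1}<-; apply/subset_leq_card/subsetP => i /setU1P Hi.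
  rewrite inE perm1 eq_sym -[_ == _]negbK suppd VE.
  case: Hi => [->|Wi]; first by rewrite (inj_eq perm_inj) (negPf xk) andbF.
  by rewrite Wi orbF; apply: contraNneq xk => <-; case/andP: (WF _ Wi).
have supp_notin (d : 'S_n) : (forall i, (d i != i) = (i \in V)) -> d \notin B.
  move=> suppd; apply/negP => /(cAB _ _ Ax); apply/negP; rewrite -ltnNge.
  have : #|W| < t by card_lia.
  apply: leq_ltn_trans; apply/subset_leq_card/subsetP => i; rewrite inE => /eqP xdi.
  apply: contraT => nWi; have := suppd i; rewrite -xdi VE nWi /=.
  have [eik _|nik] := eqVneq i k; last by case: eqP.
  rewrite {i nWi}eik in xdi; have := suppd (d k); rewrite (inj_eq perm_inj) suppd Vk -xdi VE.
  by rewrite (inj_eq perm_inj) (negPf xk) andbF.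
apply: (atom_norm (c := c) atAB A1); [exact: supp_ball | exact: supp_notin |].
apply: supp_notin => i; rewrite tpermV.
have -> : (c ^ tperm j k) i = tperm j k (c (tperm j k i)).
  by rewrite conjgE tpermV !permM.
rewrite -(inj_eq (@perm_inj _ (tperm j k))) tpermK suppc.
by case: tpermP => [->|->|]; rewrite ?Vj ?Vk.
Qed.

(** If 1 is not in [B], [atom_norm] applies with [c = 1], which every conjugation fixes. Otherwise
    the transpositions through a fixed point [j] of some [x] in [A] normalize [A] and generate. *)
Lemma atom_normal n t (A B : {set 'S_n}) :
  atom t A B -> 0 < t -> t <= n -> 1 \in A -> 'N(A) = [set: 'S_n].
Proof.
move=> atAB t0 tn A1; have [cAB A2 _ _ _] := atAB.
have [B1|nB1] := boolP (1 \in B); last first.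
  apply/setP=> g; rewrite in_setT; apply: (atom_norm (c := 1) atAB); rewrite ?conj1g //.
  rewrite inE (_ : agree 1 1 = setT) ?cardsT ?card_ord //.
  by apply/setP => i; rewrite !inE eqxx.
have [x nx1 Ax] := exists_neq1 A2.
have [j] : exists j, j \in agree x 1.
  by apply/set0Pn; rewrite -card_gt0; apply: leq_trans t0 (cAB _ _ Ax B1).
rewrite inE perm1 => /eqP xj.
have [k xk] := perm_neq1_moves nx1.
have jN i : x i != i -> tperm j i \in 'N(A) by apply: atom_tperm_norm atAB _ _ _ _ _.
apply/eqP; rewrite eqEsubset subsetT -(gen_tperm j) gen_subG /=.
apply/subsetP => _ /imsetP[y _ ->].
have [xy|] := eqVneq (x y) y; last exact: jN.
have [->|nyj] := eqVneq y j; first by rewrite tperm1 group1.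
have nyk : y != k by apply: contraNneq xk => <-; rewrite xy.
have njk : j != k by apply: contraNneq xk => <-; rewrite xj.
have -> : tperm j y = tperm j k ^ tperm y k.
  by rewrite tpermJ tpermR tpermD // eq_sym.
by rewrite groupJ ?jN // (atom_tperm_norm (x := x) atAB).
Qed.

(* u |-> p * u^-1 * q exchanges p and q, hence stabilizes A when p and q are
   distinct elements of A. *)
Lemma atom_divg_closed n t (A B : {set 'S_n}) q r :
  atom t A B -> 1 \in A -> 2 < #|A| -> q \in A -> r \in A -> q^-1 * r \in A.
Proof.
move=> atAB A1 A3 Aq Ar; have [->|nqr] := eqVneq q r; first by rewrite mulVg.
have [p /setDP[Ap]] : exists p, p \in A :\: [set q; r].
  apply/set0Pn; rewrite -card_gt0; have := cardsID [set q; r] A.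
  have := subset_leq_card (subsetIr A [set q; r]); rewrite cards2 nqr; card_lia.
rewrite !inE negb_or => /andP[npq npr].
have swap z : z \in A -> p != z -> [set p * u^-1 * z | u in A] = A.
  move=> Az npz; apply: (atom_image_eq atAB).
    apply: (agree_preserving_comp (g := fun u => p * u^-1) (agree_preserving_mulr z)).
    exact: agree_preserving_comp (agree_preserving_mull p) (agree_preserving_inv n).
  have <- : #|[set p; z]| = 2 by rewrite cards2 npz.
  apply/subset_leq_card/subsetP => u /set2P[] ->; rewrite inE ?Ap ?Az /=.
    by apply/imsetP; exists z; rewrite ?mulgKV.
  by apply/imsetP; exists p; rewrite ?mulgV ?mul1g.
(* From [1 = p * u^-1 * q] follows [q^-1 * r = p * u^-1 * r], an image under the map exchanging [p]
   and [r]. *)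
have /imsetP[u Au e1] : 1 \in [set p * u^-1 * q | u in A] by rewrite swap.
rewrite -(swap r) //; apply/imsetP; exists u => //.
by rewrite -[q^-1]mul1g e1 mulgK.
Qed.

(** * Three-cycles, fixed points and the contradiction *)

Lemma exists_notin3 n (x y z : 'I_n) :
  3 < n -> exists w : 'I_n, [&& w != x, w != y & w != z].
Proof.
move=> n4; have [w] : exists w, w \in ~: [set x; y; z].
  apply/set0Pn; rewrite -card_gt0 cardsCs setCK card_ord.
  have := (leq_card_setU [set x; y] [set z]).1; rewrite cards1 cards2; case: (x != y); card_lia.
by rewrite !inE !negb_or -andbA => ?; exists w.
Qed.

Lemma tperm2_conj n (A : {set 'S_n}) (a b d : 'I_n) (g : 'S_n) :
  'N(A) = [set: 'S_n] -> tperm a b * tperm a d \in A ->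
  tperm (g a) (g b) * tperm (g a) (g d) \in A.
Proof. by move=> NA; rewrite -!tpermJ -conjMg memJ_norm // NA in_setT. Qed.

(** Such products are 3-cycles, all conjugate; the conjugator corrects the images of [a], [b], [d]
    in turn by transpositions. *)
Lemma tperm2_mem n (A : {set 'S_n}) (a b d a' b' d' : 'I_n) :
  'N(A) = [set: 'S_n] -> uniq [:: a; b; d] -> uniq [:: a'; b'; d'] ->
  tperm a b * tperm a d \in A -> tperm a' b' * tperm a' d' \in A.
Proof.
move=> NA U U' Aabd.
have [s [<- <- <-]] : exists s : 'S_n, [/\ s a = a', s b = b' & s d = d'].
  pose g := tperm a a'; pose h := tperm (g b) b'.
  have ga : g a = a' by rewrite /g tpermL.
  move: U U'; rewrite /= !inE !negb_or !andbT => /andP[/andP[nab nad] nbd].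
  move=> /andP[/andP[nab' nad'] nbd'].
  have ha : h a' = a' by rewrite /h tpermD 1?eq_sym // -ga (inj_eq perm_inj).
  have hb : h (g b) = b' by rewrite /h tpermL.
  exists (g * h * tperm (h (g d)) d'); rewrite !permM ga ha hb; split.
  - by rewrite tpermD 1?eq_sym // -ha -ga !(inj_eq perm_inj).
  - by rewrite tpermD 1?eq_sym // -hb !(inj_eq perm_inj).
  - by rewrite tpermL.
exact: tperm2_conj.
Qed.

(* Right multiplication by a suitable 3-cycle through a fixed point of c
   strictly shrinks the set of fixed points of c. *)
Lemma atom_no_fixpoint n t (A B : {set 'S_n}) x j :
  3 < n -> 0 < t -> t <= n -> atom t A B -> 1 \in A -> 2 < #|A| ->
  x \in A -> x != 1 -> x j != j.
Proof.
move=> n4 t0 tn atAB A1 A3 Ax nx1; apply/eqP => xj.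
have [cAB A2 leAB _ _] := atAB.
have NA := atom_normal atAB t0 tn A1.
have divA q r : q \in A -> r \in A -> q^-1 * r \in A by exact: atom_divg_closed atAB A1 A3.
have mulA q r : q \in A -> r \in A -> q * r \in A.
  by move=> Aq Ar; rewrite -[q]invgK divA // -[q^-1]mulg1 divA.
have [k xk] := perm_neq1_moves nx1.
have A3c a b d : uniq [:: a; b; d] -> tperm a b * tperm a d \in A.
  move=> U; apply: (tperm2_mem (a := j) (b := x k) (d := k)) => //.
    rewrite /= !inE negb_or xk !andbT.
    have njk : j != k by apply: contraNneq xk => <-; rewrite xj.
    by rewrite njk -{1}xj (inj_eq perm_inj) njk.
  (* The 3-cycle is the commutator of [x] and [tperm j k]. *)
  have -> : tperm j (x k) * tperm j k = x^-1 * x ^ tperm j k.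
    have -> : tperm j (x k) = tperm j k ^ x by rewrite tpermJ xj.
    by rewrite !conjgE tpermV !mulgA.
  by rewrite divA // memJ_norm // NA in_setT.
have [c0 Bc0] : exists c, c \in B by apply/set0Pn; rewrite -card_gt0; card_lia.
case: (@arg_minnP _ c0 (mem B) (fun c => #|agree 1 c|) Bc0) => c Bc minc.
have [a] : exists a, a \in agree 1 c.
  by apply/set0Pn; rewrite -card_gt0; apply: leq_trans t0 (cAB _ _ A1 Bc).
rewrite inE perm1 eq_sym => /eqP ca.
have [b /and3P[nba _ _]] := exists_notin3 a a a n4.
(* The 3-cycle [w] below sends [b] to [d], so [c d = b] would make [d] a new fixed point of
   [c * w]. *)
have [d /and3P[nda ndb ndcb]] := exists_notin3 a b (c^-1 b) n4.
have ncd : c d != b by rewrite -[b](permKV c) (inj_eq perm_inj).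
pose w := tperm a b * tperm a d.
have Aw : w \in A by apply: A3c; rewrite /= !inE negb_or !(eq_sym a) nba nda eq_sym ndb.
have wA : [set u * w | u in A] = A.
  apply/eqP; rewrite eqEcard card_imset ?leqnn ?andbT; last exact: mulIg.
  by apply/subsetP => _ /imsetP[u Au ->]; apply: mulA.
have wa : w a = b by rewrite permM tpermL tpermD // eq_sym.
have wb : w b = d by rewrite permM tpermR tpermL.
have wd : w d = a by rewrite permM (_ : tperm a b d = d) ?tpermR // tpermD // eq_sym.
have := minc _ (atom_fix atAB (agree_preserving_mulr w) wA Bc); apply/negP; rewrite -ltnNge.
apply/proper_card/properP; split; last first.
  exists a; first by rewrite inE perm1 ca.
  by rewrite inE perm1 permM ca wa eq_sym.
apply/subsetP => e; rewrite !inE perm1 permM => /eqP ewc; apply/eqP.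
have [cea|ncea] := eqVneq (c e) a.
  have eb : e = b by rewrite ewc cea wa.
  by case/eqP: nba; rewrite -eb; apply: (@perm_inj _ c); rewrite cea ca.
have [ceb|nceb] := eqVneq (c e) b.
  have ed : e = d by rewrite ewc ceb wb.
  by case/eqP: ncd; rewrite -ed.
have [ced|nced] := eqVneq (c e) d.
  have ea : e = a by rewrite ewc ced wd.
  by case/eqP: nda; rewrite -ced ea ca.
by rewrite {1}ewc permM !tpermD // eq_sym.
Qed.

(* If x in A is fixed-point free, it agrees nowhere with some transposition, so B
   contains no transposition at all. *)
Lemma atom_pair_false n t (A B : {set 'S_n}) :
  3 < n -> 0 < t -> t <= n - 2 -> atom t A B -> 1 \in A -> False.
Proof.
move=> n4 t0 tn2 atAB A1; have [cAB A2 leAB gtM maxAB] := atAB.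
have tn : t <= n by lia.
have NA := atom_normal atAB t0 tn A1.
have JB g c : c \in B -> c ^ g \in B.
  apply: (atom_fix (f := conjg^~ g) atAB (agree_preserving_conj g)).
  by apply/normP; rewrite NA in_setT.
have [x nx1 Ax] := exists_neq1 A2.
have [k xk] := perm_neq1_moves nx1.
have A3 : 2 < #|A|.
  have [l /and3P[nlk nlxk _]] := exists_notin3 k (x k) k n4.
  pose y := x ^ tperm (x k) l.
  have yk : y k = l.
    by rewrite /y conjgE tpermV !permM (tpermD xk nlk) tpermL.
  apply/card_gt2P; exists 1, x, y; split; split=> //.
  - by rewrite memJ_norm // NA in_setT.
  - by rewrite eq_sym.
  - by apply: contraNneq nlxk => ->; rewrite yk.
  - by apply: contraNneq nlk => y1; rewrite -yk y1 perm1.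
have nfix y i : y \in A -> y != 1 -> y i != i by exact: atom_no_fixpoint n4 t0 tn atAB A1 A3.
(* Quotients of members of [A] lie in [A] and, unless trivial, fix no point, so the value at [k]
   determines a member. *)
have leAn : #|A| <= n.
  have inj : {in A &, injective (fun y : 'S_n => y k)}.
    move=> y z Ay Az /= eyz; apply/eqP; rewrite eq_mulVg1; apply: contraT => ne1.
    have ne2 : z^-1 * y != 1 by rewrite -eq_mulVg1 eq_sym eq_mulVg1.
    have /eqP[] := nfix _ (z k) (atom_divg_closed atAB A1 A3 Az Ay) ne2.
    by rewrite permM permK eyz.
  by rewrite -(card_in_imset inj) -[leqRHS]card_ord max_card.
have nB1 : 1 \notin B.
  apply/negP => /(cAB _ _ Ax); apply/negP; rewrite -ltnNge.
  suff -> : agree x 1 = set0 by rewrite cards0.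
  by apply/setP => i; rewrite !inE perm1 (negPf (nfix _ _ Ax nx1)).
(* Avoiding [x k] and [x^-1 k] makes [x] disagree with [tperm k b] at [k] and at [b]. *)
have [b /and3P[nbk nbxk nbVk]] := exists_notin3 k (x k) (x^-1 k) n4.
have nBkb : tperm k b \notin B.
  apply/negP => /(cAB _ _ Ax); apply/negP; rewrite -ltnNge.
  suff -> : agree x (tperm k b) = set0 by rewrite cards0.
  apply/setP => i; rewrite !inE; apply/negbTE.
  case: tpermP => [->|->|_ _]; [by rewrite eq_sym | | exact: nfix].
  by rewrite -[k in _ == k](permKV x) (inj_eq perm_inj).
have nBk l : tperm k l \notin B.
  have [<-|nkl] := eqVneq k l; first by rewrite tperm1.
  apply: contra nBkb => /(JB (tperm l b)).
  have [-> | nlb] := eqVneq l b; first by rewrite tperm1 conjg1.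
  by rewrite tpermJ tpermL tpermD // eq_sym.
(* With the identity at [l = k], these are exactly [n] permutations, each with at least [n - 2]
   fixed points; so [B] has at least [n] fewer elements than the ball. *)
have sub : [set tperm k l | l : 'I_n] \subset ball t 1 :\: B.
  apply/subsetP => _ /imsetP[l _ ->]; rewrite in_setD nBk inE.
  have : n - 2 <= #|~: [set k; l]|.
    by have := cardsC [set k; l]; rewrite card_ord cards2; case: (k != l); card_lia.
  move=> le2; apply: leq_trans tn2 (leq_trans le2 _).
  apply/subset_leq_card/subsetP => i; rewrite !inE negb_or perm1 => /andP[nik nil].
  by rewrite tpermD // eq_sym.
have := subset_leq_card sub; rewrite card_imset; last first.
  by move=> l l' /(congr1 (fun s : 'S_n => s k)); rewrite !tpermL.
rewrite cardT size_enum_ord.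
have := cardsID B (ball t 1).
have -> : ball t 1 :&: B = B by apply/setIidPr/(cross_sub_ball cAB A1).
card_lia.
Qed.

Lemma cross_card_le n t (A B : {set 'S_n}) :
  3 < n -> 0 < t -> t <= n - 2 -> cross_intersecting t A B ->
  1 < #|A| -> 1 < #|B| -> #|A| + #|B| <= #|ball t (1 : 'S_n)|.
Proof.
move=> n4 t0 tn cAB A2 B2; rewrite leqNgt; apply/negP => gtM.
have [A' [B' [atAB A'1]]] := exists_atom cAB A2 B2 gtM.
exact: atom_pair_false n4 t0 tn atAB A'1.
Qed.

Local Close Scope group_scope.

(** * Counting permutations by the set of moved points *)

(** These are the derangements of [V], extended by the identity so that all supports live in one
    type. *)
Definition support_class (T : finType) (V : {set T}) : {set {perm T}} :=
  [set s : {perm T} | [set i | s i != i] == V].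

Lemma sum_card_subsets (T : finType) (V : {set T}) m (F : nat -> nat) :
  \sum_(W : {set T} | (W \subset V) && (#|W| < m)) F #|W| =
  \sum_(k < m) 'C(#|V|, k) * F k.
Proof.
elim: m => [|m IHm]; first by rewrite big_ord0 big_pred0 // => W; rewrite ltn0 andbF.
rewrite big_ord_recr /= -IHm (bigID (fun W : {set T} => #|W| < m)) /=; congr (_ + _).
  by apply: eq_bigl => W; rewrite ltnS -andbA; congr (_ && _); lia.
rewrite -cards_draws -sum_nat_const; apply: eq_big => [W|W /andP[/andP[_]]].
  by rewrite inE ltnS -andbA; congr (_ && _); lia.
by move=> le1 le2; congr F; lia.
Qed.

Lemma sum_card_support_class (T : finType) (V : {set T}) :
  \sum_(W : {set T} | W \subset V) #|support_class W| = #|V|`!.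
Proof.
rewrite -card_perm -sum1_card.
rewrite (partition_big (fun s : {perm T} => [set i | s i != i])
          (fun W : {set T} => W \subset V)) /=; last first.
  by move=> s /subsetP sV; apply/subsetP => i; rewrite inE => /sV.
apply: eq_bigr => W /subsetP sWV; rewrite -sum1_card; apply: eq_bigl => s.
rewrite inE; case: eqP => [eW|]; rewrite ?andbF // andbT; apply/esym/subsetP => i si.
by apply: sWV; rewrite -eW inE.
Qed.

Lemma card_support_class_rec (T : finType) (V : {set T}) :
  (forall W : {set T}, #|W| < #|V| -> #|support_class W| = num_derangements #|W|) ->
  #|support_class V| = #|V|`! - \sum_(k < #|V|) 'C(#|V|, k) * num_derangements k.
Proof.
move=> IH; rewrite -sum_card_support_class (bigD1 V) //= -sum_card_subsets.
rewrite (eq_bigl (fun W : {set T} => (W \subset V) && (#|W| < #|V|))); last first.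
  by move=> W; rewrite andbC -properEneq properEcard.
by rewrite (eq_bigr _ (fun W h => IH W (proj2 (andP h)))) addnK.
Qed.

(* By strong induction, since the recursion determines the count from #|V|. *)
Lemma card_support_class (T : finType) (V : {set T}) :
  #|support_class V| = num_derangements #|V|.
Proof.
move: {2}#|V| (erefl #|V|) => m; elim/ltn_ind: m T V => m IHm T V eV.
have classT : num_derangements m = #|support_class [set: 'I_m]|.
  apply: eq_card => s; rewrite !inE; apply/forallP/eqP => [ds | /setP ds i].
    by apply/setP => i; rewrite !inE ds.
  by have := ds i; rewrite !inE.
(* Both counts obey the same recursion; quantifying over [T] lets the induction serve [V] and ['I_m]
   alike. *)
rewrite eV classT !card_support_class_rec ?cardsT ?card_ord ?eV // => W ltW.
  exact: IHm ltW _ _ _.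
exact: IHm ltW _ _ _.
Qed.

(** Partition by the set [W] of fixed points: what remains is a derangement of its complement. *)
Lemma card_nbrs1 n t :
  #|nbrs t (1%g : 'S_n)| = \sum_(0 <= i < t) 'C(n, i) * num_derangements (n - i).
Proof.
have := sum_card_subsets [set: 'I_n] t (fun i => num_derangements (n - i)).
rewrite cardsT card_ord big_mkord => <-.
rewrite -sum1_card (partition_big (fun u => agree 1%g u)
  (fun W : {set 'I_n} => (W \subset setT) && (#|W| < t))) /=; last first.
  by move=> u; rewrite inE subsetT.
apply: eq_bigr => W /andP[_ ltW].
have -> : n - #|W| = #|~: W| by have := cardsC W; rewrite card_ord; card_lia.
rewrite -card_support_class -sum1_card; apply: eq_bigl => u.
have eC : [set i | u i != i] = ~: agree 1%g u.
  by apply/setP => i; rewrite !inE perm1 eq_sym.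
rewrite !inE eC (inj_eq (@setC_inj _)); case: eqP => [->|]; last by rewrite andbF.
by rewrite ltW.
Qed.

Lemma setT_nbrs n t (s : 'S_n) : [set: 'S_n] :\: nbrs t s = ball t s.
Proof. by apply/setP => u; rewrite !inE -leqNgt andbT. Qed.

Lemma card_ball1 n t :
  #|ball t (1%g : 'S_n)| =
  n`! - \sum_(0 <= i < t) 'C(n, i) * num_derangements (n - i).
Proof. by rewrite -setT_nbrs -card_nbrs1 cardsDS ?subsetT // cardsT card_Sn. Qed.

(* The truncated subtraction n`! - _ is exact: the sum counts the permutations
   with fewer than t fixed points. *)
Theorem theorem1p4 (n t : nat) (A B : {set 'S_n}) :
  0 < n -> 0 < t -> 4 <= n -> t <= n - 2 ->
  A != set0 -> B != set0 ->
  cross_intersecting t A B ->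
  #|A| + #|B| <= n`! - (\sum_(0 <= i < t) 'C(n, i) * num_derangements (n - i)) + 1
  /\ (#|A| + #|B| = n`! - (\sum_(0 <= i < t) 'C(n, i) * num_derangements (n - i)) + 1 <->
      exists s : 'S_n, [set A; B] = [set [set s]; [set: 'S_n] :\: nbrs t s]).
Proof.
move=> _ t0 n4 tn A0 B0 cAB; rewrite -card_ball1.
have single (A' B' : {set 'S_n}) : cross_intersecting t A' B' -> #|A'| = 1 ->
    exists s, [/\ A' = [set s], #|B'| <= #|ball t (1%g : 'S_n)|
             & #|B'| = #|ball t (1%g : 'S_n)| -> B' = ball t s].
  move=> cAB' /eqP/cards1P[s eA]; exists s; split=> //.
    by rewrite -(card_ball t s) subset_leq_card // (cross_sub_ball cAB') // eA set11.
  move=> eB; apply/eqP.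
  by rewrite eqEcard card_ball eB leqnn andbT (cross_sub_ball cAB') // eA set11.
have [A1 B1] : 0 < #|A| /\ 0 < #|B| by rewrite !card_gt0.
(* Memberships in both directions give the sizes without deciding which family is the singleton. *)
have card_pair s : [set A; B] = [set [set s]; ball t s] ->
    #|A| + #|B| = #|ball t (1%g : 'S_n)| + 1.
  move=> eAB; rewrite -(card_ball t s).
  have cA : #|A| = 1 \/ #|A| = #|ball t s|.
    have : A \in [set A; B] by rewrite set21.
    by rewrite eAB => /set2P[]->; rewrite ?cards1; auto.
  have cB : #|B| = 1 \/ #|B| = #|ball t s|.
    have : B \in [set A; B] by rewrite set22.
    by rewrite eAB => /set2P[]->; rewrite ?cards1; auto.
  have c1 : #|A| = 1 \/ #|B| = 1.
    have : [set s] \in [set A; B] by rewrite eAB set21.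
    by move=> /set2P[]<-; rewrite cards1; auto.
  have cb : #|A| = #|ball t s| \/ #|B| = #|ball t s|.
    have : ball t s \in [set A; B] by rewrite eAB set22.
    by move=> /set2P[]<-; auto.
  by move: cA cB c1 cb; card_lia.
have pair_card : #|A| + #|B| = #|ball t (1%g : 'S_n)| + 1 ->
    #|A| = 1 \/ #|B| = 1 -> exists s, [set A; B] = [set [set s]; ball t s].
  move=> eq [eA|eB].
    have [s [-> _ eqB]] := single A B cAB eA.
    by exists s; rewrite -eqB //; card_lia.
  have [s [-> _ eqA]] := single B A (crossC cAB) eB.
  by exists s; rewrite -eqA 1?setUC //; card_lia.
(* Two families of size at least 2 stay below the bound by one, so equality forces a singleton. *)
have large : #|A| = 1 \/ #|B| = 1 \/ #|A| + #|B| <= #|ball t (1%g : 'S_n)|.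
  have [eA|nA1] := eqVneq #|A| 1; first by left.
  have [eB|nB1] := eqVneq #|B| 1; first by right; left.
  by right; right; apply: cross_card_le cAB _ _ => //; card_lia.
split.
  case: large => [eA|[eB|]]; last by card_lia.
    by have [s [_ le _]] := single A B cAB eA; card_lia.
  by have [s [_ le _]] := single B A (crossC cAB) eB; card_lia.
split=> [eq|[s]]; last by rewrite setT_nbrs; apply: card_pair.
have [|s es] := pair_card eq; last by exists s; rewrite setT_nbrs.
by case: large => [|[|]]; auto; card_lia.
Qed.
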